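(* Let $\mathfrak{g}$ be a Lie algebra over a field $\mathbb{K}$ and let $t_{\mathfrak{g}}\colon HL_2(\mathfrak{g})\to H_2(\mathfrak{g})$ be the natural epimorphism from the second Leibniz homology to the second Chevalley–Eilenberg homology. Then there exists a vector subspace $V$ of $\operatorname{Ker}(t_{\mathfrak{g}})$ together with an epimorphism (surjective linear map) $V\to\Gamma(\mathfrak{g}^{\mathrm{ab}})$, where $\mathfrak{g}^{\mathrm{ab}}=\mathfrak{g}/[\mathfrak{g},\mathfrak{g}]$. Hence, if $\mathfrak{g}$ is not perfect (i.e. $\mathfrak{g}\ne[\mathfrak{g},\mathfrak{g}]$), then $t_{\mathfrak{g}}$ is not an isomorphism.
   Context: $\mathbb{K}$ is a field, $\otimes=\otimes_{\mathbb{K}}$. A Lie algebra is regarded as a Leibniz algebra, i.e. a vector space with bilinear bracket satisfying $[x,[y,z]]=[[x,y],z]-[[x,z],y]$. $HL_n(\mathfrak{g})$ is the $n$-th homology of the complex with $CL_n(\mathfrak{g})=\mathfrak{g}^{\otimes n}$, $d(x)=0$ for $x\in\mathfrak{g}$, and for $n>1$ $$d(x_1\otimes\cdots\otimes x_n)=\sum_{1\le i<j\le n}(-1)^j\, x_1\otimes\cdots\otimes x_{i-1}\otimes[x_i,x_j]\otimes x_{i+1}\otimes\cdots\otimes\widehat{x_j}\otimes\cdots\otimes x_n .$$ $H_n(\mathfrak{g})$ is the Chevalley–Eilenberg homology with trivial coefficients $\mathbb{K}$, the homology of the complex $\Lambda^n\mathfrak{g}$ with the boundary given by the same formula with $\otimes$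 replaced by $\wedge$. The natural map $t_{\mathfrak{g}}$ is induced by the canonical projections $\mathfrak{g}^{\otimes n}\to\Lambda^n\mathfrak{g}$. Universal quadratic functor: for a $\mathbb{K}$-module $A$, $\Gamma(A)$ is the $\mathbb{K}$-module generated by symbols $\gamma(a)$, $a\in A$, subject to $k^2\gamma(a)=\gamma(ka)$; $\gamma(a+b+c)+\gamma(a)+\gamma(b)+\gamma(c)=\gamma(a+b)+\gamma(a+c)+\gamma(b+c)$; $\gamma(ka+b)+k\gamma(a)+k\gamma(b)=k\gamma(a+b)+\gamma(ka)+\gamma(b)$ for $k\in\mathbb{K}$, $a,b,c\in A$. *)

(* Defs.v *)
From HB Require Import structures.
From mathcomp Require Import all_boot all_algebra.
From mathcomp Require Import finmap boolp.
From mathcomp.multinomials Require Import monalg.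

Set Implicit Arguments.
Unset Strict Implicit.
Unset Printing Implicit Defensive.

Import GRing.Theory.
Local Open Scope ring_scope.
Local Open Scope quotient_scope.

Section Subspaces.
Context (K : fieldType).

Definition span_pred (V : lmodType K) (R : V -> Prop) : {pred V} := fun v =>
  `[< forall W : submodClosed V, (forall r, R r -> r \in W) -> v \in W >].

Fact span_submod (V : lmodType K) (R : V -> Prop) :
  subsemimod_closed (span_pred R).
Proof.
split; first split.
- by apply/asboolP => W _; apply: rpred0.
- move=> u v /asboolP Ru /asboolP Rv; apply/asboolP => W RW.
  by apply: rpredD; [apply: Ru | apply: Rv].
- move=> a v /asboolP Rv; apply/asboolP => W RW.
  by apply: rpredZ; apply: Rv.
Qed.

HB.instance Definition _ (V : lmodType K) (R : V -> Prop) :=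
  GRing.isSubmodClosed.Build K V (span_pred R) (span_submod R).

Definition span (V : lmodType K) (R : V -> Prop) : submodClosed V := span_pred R.

Lemma mem_span (V : lmodType K) (R : V -> Prop) r : R r -> r \in span R.
Proof. by move=> Rr; apply/asboolP => W; apply. Qed.

Lemma span_min (V : lmodType K) (R : V -> Prop) (W : submodClosed V) :
  (forall r, R r -> r \in W) -> {subset span R <= W}.
Proof. by move=> RW v /asboolP; apply. Qed.

Definition kernel_pred (U V : lmodType K) (f : {linear U -> V}) : {pred U} :=
  fun u => f u == 0.

Fact kernel_submod (U V : lmodType K) (f : {linear U -> V}) :
  subsemimod_closed (kernel_pred f).
Proof.
split; first split.
- by apply/eqP; rewrite linear0.
- by move=> u v /eqP fu /eqP fv; apply/eqP; rewrite linearD fu fv addr0.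
- by move=> a v /eqP fv; apply/eqP; rewrite linearZ /= fv scaler0.
Qed.

HB.instance Definition _ (U V : lmodType K) (f : {linear U -> V}) :=
  GRing.isSubmodClosed.Build K U (kernel_pred f) (kernel_submod f).

Definition kernel (U V : lmodType K) (f : {linear U -> V}) : submodClosed U :=
  kernel_pred f.

Lemma kernelP (U V : lmodType K) (f : {linear U -> V}) u :
  reflect (f u = 0) (u \in kernel f).
Proof. exact: eqP. Qed.

Record subspace_of (V : lmodType K) (W : submodClosed V) :=
  Subspace { subspace_val : V; _ : subspace_val \in W }.

HB.instance Definition _ (V : lmodType K) (W : submodClosed V) :=
  [isSub for @subspace_val V W].
HB.instance Definition _ (V : lmodType K) (W : submodClosed V) :=
  [Choice of subspace_of W by <:].
HB.instance Definition _ (V : lmodType K) (W : submodClosed V) :=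
  [SubChoice_isSubLmodule of subspace_of W by <:].

Definition subspace (V : lmodType K) (W : submodClosed V) : lmodType K :=
  subspace_of W.

Definition incl (V : lmodType K) (W : submodClosed V) :
  {linear subspace W -> V} := (val : subspace_of W -> V).

Lemma incl_mem (V : lmodType K) (W : submodClosed V) (z : subspace W) :
  incl W z \in W.
Proof. exact: (valP (z : subspace_of W)). Qed.

Lemma incl_inj (V : lmodType K) (W : submodClosed V) : injective (incl W).
Proof. exact: (val_inj : injective (val : subspace_of W -> V)). Qed.

Lemma incl_surj (V : lmodType K) (W : submodClosed V) v :
  v \in W -> exists z, incl W z = v.
Proof. by move=> Wv; exists (Subspace Wv). Qed.

Section Corestriction.
Context (U V : lmodType K) (W : submodClosed V) (f : {linear U -> V}).
Context (fW : forall u, f u \in W).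

Definition corestr_fun (u : U) : subspace W := Subspace (fW u).

Fact corestr_linear : linear corestr_fun.
Proof. by move=> a u v; apply: incl_inj; rewrite linearP /= -linearP. Qed.

HB.instance Definition _ :=
  GRing.isLinear.Build K U (subspace W) _ corestr_fun corestr_linear.

Definition corestr : {linear U -> subspace W} := corestr_fun.

Lemma incl_corestr u : incl W (corestr u) = f u.
Proof. by []. Qed.

End Corestriction.

Lemma span_kernel (U V : lmodType K) (f : {linear U -> V}) (R : U -> Prop) :
  (forall r, R r -> f r = 0) -> {subset span R <= kernel f}.
Proof. by move=> fR; apply: span_min => r /fR fr; apply/kernelP. Qed.

Lemma span_empty (V : lmodType K) (R : V -> Prop) v :
  (forall r, ~ R r) -> v \in span R -> v = 0.
Proof.
move=> R0 Rv; have R0' r : R r -> (idfun : {linear V -> V}) r = 0 by move/R0.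
exact: (kernelP _ _ (span_kernel R0' Rv)).
Qed.

End Subspaces.
(* Opaque constants (here and below) keep unification and simplification from
   unfolding towers of quotients; they are used through the lemmas above. *)
#[global] Opaque span kernel subspace incl corestr.

Section Quotients.
Context (K : fieldType) (V : lmodType K) (W : submodClosed V).

(* W again, declared closed under opposites: submodClosed does not inherit from
   the zmodClosed structure expected by the quotient of zmodules. *)
Definition zmod_of_submod : {pred V} := fun v => v \in W.

Fact zmod_of_submod_closed : zmod_closed zmod_of_submod.
Proof.
split=> [|u v Wu Wv]; first exact: rpred0.
by rewrite /zmod_of_submod unfold_in; apply: rpredD => //; rewrite -scaleN1r;
  apply: rpredZ.
Qed.

HB.instance Definition _ :=
  GRing.isZmodClosed.Build V zmod_of_submod zmod_of_submod_closed.

Definition quotient_type := @Quotient.quot V zmod_of_submod.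

HB.instance Definition _ := GRing.Zmodule.on quotient_type.

Definition qproj_fun (v : V) : quotient_type := \pi_quotient_type v.

Fact qproj_fun_repr (q : quotient_type) : qproj_fun (repr q) = q.
Proof. exact: reprK. Qed.

Fact qproj_fun_eq u v : (qproj_fun u == qproj_fun v) = (u - v \in W).
Proof. by rewrite -[LHS]Quotient.idealrBE. Qed.

Fact qproj_funD u v : qproj_fun (u + v) = qproj_fun u + qproj_fun v.
Proof. exact: (raddfD \pi_(@Quotient.quot V zmod_of_submod)). Qed.

Definition quotient_scale (a : K) (q : quotient_type) : quotient_type :=
  qproj_fun (a *: repr q).

Fact quotient_scale_proj a v : quotient_scale a (qproj_fun v) = qproj_fun (a *: v).
Proof.
by apply/eqP; rewrite qproj_fun_eq -scalerBr rpredZ // -qproj_fun_eq qproj_fun_repr.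
Qed.

Fact quotient_scalerA a b q :
  quotient_scale a (quotient_scale b q) = quotient_scale (a * b) q.
Proof. by rewrite -(qproj_fun_repr q) !quotient_scale_proj scalerA. Qed.

Fact quotient_scale1r : left_id 1 quotient_scale.
Proof. by move=> q; rewrite -(qproj_fun_repr q) quotient_scale_proj scale1r. Qed.

Fact quotient_scalerDr : right_distributive quotient_scale +%R.
Proof.
move=> a p q; rewrite -(qproj_fun_repr p) -(qproj_fun_repr q) -qproj_funD.
by rewrite !quotient_scale_proj scalerDr qproj_funD.
Qed.

Fact quotient_scalerDl q : {morph quotient_scale^~ q : a b / a + b}.
Proof.
by move=> a b; rewrite -(qproj_fun_repr q) !quotient_scale_proj scalerDl qproj_funD.
Qed.

HB.instance Definition _ := GRing.Zmodule_isLmodule.Build K quotient_type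
  quotient_scalerA quotient_scale1r quotient_scalerDr quotient_scalerDl.

Fact qproj_linear : linear qproj_fun.
Proof. by move=> a u v; rewrite qproj_funD -quotient_scale_proj. Qed.

HB.instance Definition _ := GRing.isLinear.Build K V quotient_type _ qproj_fun
  qproj_linear.

Definition quotient : lmodType K := quotient_type.

Definition qproj : {linear V -> quotient} := qproj_fun.

Lemma qproj_surj (q : quotient) : exists v, qproj v = q.
Proof. by exists (repr (q : quotient_type)); apply: qproj_fun_repr. Qed.

Lemma qproj_eq0 v : (qproj v == 0) = (v \in W).
Proof. by rewrite -(linear0 qproj) [LHS]qproj_fun_eq subr0. Qed.

Section Lift.
Context (U : lmodType K) (f : {linear V -> U}) (fW : {subset W <= kernel f}).

Definition qlift_fun (_ : {subset W <= kernel f}) (q : quotient) : U :=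
  f (repr (q : quotient_type)).

Lemma qlift_funE v : qlift_fun fW (qproj v) = f v.
Proof.
apply/eqP; rewrite -subr_eq0 -linearB; apply/eqP/kernelP/fW.
by rewrite -qproj_fun_eq qproj_fun_repr.
Qed.

Fact qlift_linear : linear (qlift_fun fW).
Proof.
move=> a p q; have [u <-] := qproj_surj p; have [v <-] := qproj_surj q.
by rewrite -linearP !qlift_funE linearP.
Qed.

HB.instance Definition _ := GRing.isLinear.Build K quotient U _ (qlift_fun fW)
  qlift_linear.

Definition qlift : {linear quotient -> U} := qlift_fun fW.

Lemma qliftE v : qlift (qproj v) = f v.
Proof. exact: qlift_funE. Qed.

End Lift.
End Quotients.
#[global] Opaque quotient qproj qlift.

(* The homology of a pair of composable maps U -h-> V -f-> W at V. Taking the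
   preimage of the image of h in Ker f makes the definition total: it does not
   presuppose f o h = 0. *)
Section Homology.
Context (K : fieldType) (U V W : lmodType K).
Context (h : {linear U -> V}) (f : {linear V -> W}).

Definition boundary_pred : {pred subspace (kernel f)} := fun z =>
  `[< exists u, h u = incl (kernel f) z >].

Fact boundary_submod : subsemimod_closed boundary_pred.
Proof.
split; first split.
- by apply/asboolP; exists 0; rewrite !linear0.
- move=> y z /asboolP[u hu] /asboolP[v hv]; apply/asboolP.
  by exists (u + v); rewrite !linearD hu hv.
- move=> a z /asboolP[u hu]; apply/asboolP.
  by exists (a *: u); rewrite !linearZ hu.
Qed.

HB.instance Definition _ := GRing.isSubmodClosed.Build K (subspace (kernel f))
  boundary_pred boundary_submod.

Definition boundary : submodClosed (subspace (kernel f)) := boundary_pred.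

Lemma boundaryP z :
  reflect (exists u, h u = incl (kernel f) z) (z \in boundary).
Proof. exact: asboolP. Qed.

Definition homology : lmodType K := quotient boundary.

End Homology.
#[global] Opaque boundary.

Section Presented.
Context (K : fieldType) (T : choiceType).

Section FreeLift.
Context (U : lmodType K) (h : T -> U).

Definition free_lift_fun (m : {malg K[T]}) : U :=
  \sum_(t <- msupp m) m@_t *: h t.

Lemma free_liftEw (d : {fset T}) (m : {malg K[T]}) :
  (msupp m `<=` d)%fset -> free_lift_fun m = \sum_(t <- d) m@_t *: h t.
Proof.
move=> le; rewrite /free_lift_fun (big_fset_incl _ le) // => t _ /mcoeff_outdom ->.
by rewrite scale0r.
Qed.

Fact free_lift_linear : linear free_lift_fun.
Proof.
move=> a m n; pose d := (msupp (a *: m + n) `|` (msupp m `|` msupp n))%fset.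
rewrite !(@free_liftEw d) ?fsubsetUl //; last first.
- by rewrite /d; apply/fsubsetP => x xm; rewrite !inE xm !orbT.
- by rewrite /d; apply/fsubsetP => x xm; rewrite !inE xm !orbT.
rewrite scaler_sumr -big_split /=; apply: eq_bigr => t _.
by rewrite mcoeffD mcoeffZ scalerDl scalerA.
Qed.

HB.instance Definition _ :=
  GRing.isLinear.Build K {malg K[T]} U _ free_lift_fun free_lift_linear.

Definition free_lift : {linear {malg K[T]} -> U} := free_lift_fun.

Lemma free_liftU t : free_lift << t >> = h t.
Proof. by rewrite [LHS](free_liftEw msuppU_le) big_seq_fset1 mcoeffUU scale1r. Qed.

End FreeLift.

Lemma free_lin_eq (U : lmodType K) (f g : {linear {malg K[T]} -> U}) :
  (forall t, f << t >> = g << t >>) -> f =1 g.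
Proof.
move=> fg m; rewrite [m]monalgE !linear_sum; apply: eq_bigr => t _.
have -> : << m@_t *g t >> = m@_t *: << t >> :> {malg K[T]}.
  by apply/malgP => s; rewrite mcoeffZ !mcoeffU mulrnAr mulr1.
by rewrite !linearZ fg.
Qed.

Definition presented (R : {malg K[T]} -> Prop) : lmodType K :=
  quotient (span R).

Context (R : {malg K[T]} -> Prop).

Definition pgen (t : T) : presented R := qproj (span R) << t >>.

Definition respects (U : lmodType K) (h : T -> U) :=
  forall r, R r -> free_lift h r = 0.

Definition plift (U : lmodType K) (h : T -> U) (hR : respects h) :
    {linear presented R -> U} :=
  qlift (span_kernel hR).

Lemma pliftE (U : lmodType K) (h : T -> U) (hR : respects h) t :
  plift hR (pgen t) = h t.
Proof. by rewrite [LHS]qliftE free_liftU. Qed.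

Lemma pgen_respects : respects pgen.
Proof.
move=> r Rr; have -> : free_lift pgen r = qproj (span R) r.
  by apply: free_lin_eq => t; rewrite free_liftU.
by apply/eqP; rewrite qproj_eq0 mem_span.
Qed.

Lemma presented_lin_eq (U : lmodType K) (f g : {linear presented R -> U}) :
  (forall t, f (pgen t) = g (pgen t)) -> f =1 g.
Proof.
move=> fg q; have [m <-] := qproj_surj q.
exact: (@free_lin_eq _ (f \o qproj (span R)) (g \o qproj (span R))).
Qed.

End Presented.
#[global] Opaque free_lift presented pgen plift.

Section Multilinear.
Context (K : fieldType) (A : lmodType K) (n : nat).
Implicit Types x : {ffun 'I_n -> A}.

Definition upd x (i : 'I_n) (u : A) : {ffun 'I_n -> A} :=
  [ffun k => if k == i then u else x k].

Definition multilinear (U : lmodType K) (f : {ffun 'I_n -> A} -> U) :=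
  forall x i a u v,
    f (upd x i (a *: u + v)) = a *: f (upd x i u) + f (upd x i v).

Definition alternating (U : lmodType K) (f : {ffun 'I_n -> A} -> U) :=
  forall x i j, i != j -> x i = x j -> f x = 0.

Definition tensor_rel (r : {malg K[{ffun 'I_n -> A}]}) :=
  exists x i a u v,
    r = << upd x i (a *: u + v) >>
        - (a *: << upd x i u >> + << upd x i v >>).

Definition tensor_power : lmodType K := presented tensor_rel.

Definition tensor x : tensor_power := pgen tensor_rel x.

Definition exterior_rel (t : tensor_power) :=
  exists x i j, [/\ i != j, x i = x j & t = tensor x].

Definition exterior_power : lmodType K := quotient (span exterior_rel).

Definition to_exterior : {linear tensor_power -> exterior_power} :=
  qproj (span exterior_rel).

Definition wedge x : exterior_power := to_exterior (tensor x).

Lemma tensor_multilinear : multilinear tensor.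
Proof.
move=> x i a u v; apply/eqP; rewrite -subr_eq0; apply/eqP.
have [r def_r] : {r | r = << upd x i (a *: u + v) >>
    - (a *: << upd x i u >> + << upd x i v >>) :> {malg K[{ffun 'I_n -> A}]}}.
  by eexists.
have /pgen_respects : tensor_rel r by exists x, i, a, u, v.
by rewrite def_r linearB linearP !free_liftU.
Qed.

Lemma wedge_multilinear : multilinear wedge.
Proof. by move=> x i a u v; rewrite /wedge tensor_multilinear linearP. Qed.

Lemma wedge_alternating : alternating wedge.
Proof.
move=> x i j ij xij; apply/eqP; rewrite /wedge qproj_eq0 mem_span //.
by exists x, i, j.
Qed.

Fact multilinear_respects (U : lmodType K) (f : {ffun 'I_n -> A} -> U) :
  multilinear f -> respects tensor_rel f.
Proof.
move=> fm _ [x [i [a [u [v ->]]]]].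
by rewrite linearB linearP /= !free_liftU fm subrr.
Qed.

Definition tensor_lift (U : lmodType K) (f : {ffun 'I_n -> A} -> U)
  (fm : multilinear f) : {linear tensor_power -> U} :=
  plift (multilinear_respects fm).

Lemma tensor_liftE (U : lmodType K) (f : {ffun 'I_n -> A} -> U)
  (fm : multilinear f) x : tensor_lift fm (tensor x) = f x.
Proof. exact: pliftE. Qed.

Lemma tensor_lin_eq (U : lmodType K) (f g : {linear tensor_power -> U}) :
  (forall x, f (tensor x) = g (tensor x)) -> f =1 g.
Proof. exact: presented_lin_eq. Qed.

Fact alternating_kernel (U : lmodType K) (f : {ffun 'I_n -> A} -> U)
    (fm : multilinear f) : alternating f ->
  {subset span exterior_rel <= kernel (tensor_lift fm)}.
Proof.
move=> fa; apply: span_kernel => _ [x [i [j [ij xij ->]]]] /=.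
by rewrite tensor_liftE (fa x i j).
Qed.

Definition exterior_lift (U : lmodType K) (f : {ffun 'I_n -> A} -> U)
  (fm : multilinear f) (fa : alternating f) :
  {linear exterior_power -> U} := qlift (alternating_kernel fm fa).

Lemma exterior_liftE (U : lmodType K) (f : {ffun 'I_n -> A} -> U)
  (fm : multilinear f) (fa : alternating f) x :
  exterior_lift fm fa (wedge x) = f x.
Proof. by rewrite [LHS]qliftE tensor_liftE. Qed.

Lemma exterior_lift_proj (U : lmodType K) (f : {ffun 'I_n -> A} -> U)
  (fm : multilinear f) (fa : alternating f) t :
  exterior_lift fm fa (to_exterior t) = tensor_lift fm t.
Proof. exact: qliftE. Qed.

Lemma upd_id x i : upd x i (x i) = x.
Proof. by apply/ffunP => k; rewrite ffunE; case: eqP => // ->. Qed.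

Lemma updC x i j u v : i != j -> upd (upd x i u) j v = upd (upd x j v) i u.
Proof.
by move=> ij; apply/ffunP => k; rewrite !ffunE; case: eqP => // ->;
  rewrite eq_sym (negPf ij).
Qed.

Lemma multilinearD (U : lmodType K) (f : {ffun 'I_n -> A} -> U) x i u v :
  multilinear f -> f (upd x i (u + v)) = f (upd x i u) + f (upd x i v).
Proof. by move=> fm; rewrite -{1}[u]scale1r fm scale1r. Qed.

Lemma multilinear0 (U : lmodType K) (f : {ffun 'I_n -> A} -> U) x i :
  multilinear f -> x i = 0 -> f x = 0.
Proof.
move=> fm xi; rewrite -(upd_id x i) xi; apply: (addrI (f (upd x i 0))).
by rewrite -multilinearD // !addr0.
Qed.

Lemma alternating_swap (U : lmodType K) (f : {ffun 'I_n -> A} -> U) i j :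
    multilinear f -> i != j -> (forall x, x i = x j -> f x = 0) ->
  forall x u v, f (upd (upd x i u) j v) + f (upd (upd x i v) j u) = 0.
Proof.
move=> fm ij f0 x u v.
have f0' w : f (upd (upd x i w) j w) = 0.
  by apply: f0; rewrite !ffunE !eqxx (negPf ij).
have := f0' (u + v); rewrite multilinearD //.
rewrite !(updC _ _ _ ij) !multilinearD // -!(updC _ _ _ ij).
by rewrite !f0' add0r addr0 addrC.
Qed.

Lemma alternating_adjacent (U : lmodType K) (f : {ffun 'I_n -> A} -> U) :
    multilinear f ->
    (forall x (i j : 'I_n), j = i.+1 :> nat -> x i = x j -> f x = 0) ->
  alternating f.
Proof.
move=> fm f0.
suff H m x (i j : 'I_n) : (j = i + m.+1 :> nat)%N -> x i = x j -> f x = 0.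
  move=> x i j; rewrite neq_ltn => /orP[] lt xij.
    by apply: (H (j - i.+1)%N x i j) => //; rewrite addnS -addSn subnKC.
  by apply: (H (i - j.+1)%N x j i) => //; rewrite addnS -addSn subnKC.
elim: m x j => [|m IHm] x j; first by rewrite addn1; apply: f0.
move=> ji xij.
have ltk : (i + m.+1 < n)%N by have := ltn_ord j; rewrite ji addnS => /ltnW.
pose k := Ordinal ltk.
have kj : k != j by rewrite neq_ltn /= ji !addnS ltnSn.
have ik : i != k by rewrite neq_ltn /= !addnS ltnS leq_addr.
have ij : i != j by rewrite neq_ltn /= ji addnS ltnS leq_addr.
have fkj (y : {ffun _ -> A}) : y k = y j -> f y = 0 by apply: f0; rewrite /= ji addnS.
have /eqP := alternating_swap fm kj fkj x (x k) (x j).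
rewrite upd_id upd_id addr_eq0 => /eqP ->; rewrite (IHm _ k) ?oppr0 //.
by rewrite !ffunE eqxx (negPf ij) (negPf ik) (negPf kj).
Qed.

End Multilinear.

Section Gamma.
Context (K : fieldType) (A : lmodType K).

Definition Gamma_rel (r : {malg K[A]}) :=
  [\/ exists (k : K) (a : A),
        r = k ^+ 2 *: << a >> - << k *: a >>,
      exists a b c : A,
        r = (<< a + b + c >> + << a >> + << b >> + << c >>)
            - (<< a + b >> + << a + c >> + << b + c >>)
    | exists (k : K) (a b : A),
        r = (<< k *: a + b >> + k *: << a >> + k *: << b >>)
            - (k *: << a + b >> + << k *: a >> + << b >>)].

Definition Gamma : lmodType K := presented Gamma_rel.

Definition gamma (a : A) : Gamma := pgen Gamma_rel a.

End Gamma.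

HB.mixin Record Lmodule_isLeibniz (K : fieldType) g of GRing.Lmodule K g := {
  bracket : g -> g -> g;
  bracketPl : forall y, linear (bracket^~ y);
  bracketPr : forall x, linear (bracket x);
  bracket_leibniz : forall x y z,
    bracket x (bracket y z) = bracket (bracket x y) z - bracket (bracket x z) y
}.

#[short(type="leibnizAlgType")]
HB.structure Definition LeibnizAlgebra (K : fieldType) :=
  {g of GRing.Lmodule K g & Lmodule_isLeibniz K g}.

HB.mixin Record Leibniz_isLie (K : fieldType) g of LeibnizAlgebra K g := {
  bracketxx : forall x : g, bracket x x = 0
}.

#[short(type="lieAlgType")]
HB.structure Definition LieAlgebra (K : fieldType) :=
  {g of LeibnizAlgebra K g & Leibniz_isLie K g}.

(* The usual axioms of a Lie algebra, with the Jacobi identity. *)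
HB.factory Record Lmodule_isLie (K : fieldType) g of GRing.Lmodule K g := {
  bracket : g -> g -> g;
  bracketPl : forall y, linear (bracket^~ y);
  bracketPr : forall x, linear (bracket x);
  bracketxx : forall x, bracket x x = 0;
  jacobi : forall x y z,
    bracket x (bracket y z) + bracket y (bracket z x) + bracket z (bracket x y)
    = 0
}.

HB.builders Context K g of Lmodule_isLie K g.

Lemma bracketDl x y z : bracket (x + y) z = bracket x z + bracket y z.
Proof. by have := bracketPl z 1 x y; rewrite !scale1r. Qed.

Lemma bracketDr x y z : bracket x (y + z) = bracket x y + bracket x z.
Proof. by have := bracketPr x 1 y z; rewrite !scale1r. Qed.

Lemma bracketC x y : bracket x y = - bracket y x.
Proof.
apply/eqP; rewrite -addr_eq0; have := bracketxx (x + y).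
by rewrite bracketDl !bracketDr !bracketxx add0r addr0 => ->.
Qed.

Lemma bracket_leibniz x y z :
  bracket x (bracket y z) = bracket (bracket x y) z - bracket (bracket x z) y.
Proof.
have brNr u v : bracket u (- v) = - bracket u v.
  have := bracketPr u (-1) v 0; rewrite addr0 !scaleN1r => ->.
  have -> : bracket u 0 = 0.
    by apply: (addrI (bracket u 0)); rewrite -bracketDr !addr0.
  by rewrite addr0.
apply/eqP; rewrite -subr_eq0 -(jacobi x y z); apply/eqP.
rewrite (bracketC (bracket x y) z) (bracketC (bracket x z) y) (bracketC z x).
by rewrite brNr opprB opprK [- bracket y _ + _]addrC addrA addrAC.
Qed.

HB.instance Definition _ :=
  Lmodule_isLeibniz.Build K g bracketPl bracketPr bracket_leibniz.
HB.instance Definition _ := Leibniz_isLie.Build K g bracketxx.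
HB.end.

Section Abelianization.
Context (K : fieldType) (g : leibnizAlgType K).

Definition bracket_rel (z : g) := exists x y : g, z = bracket x y.

Definition derived : submodClosed g := span bracket_rel.

Definition perfect := forall x : g, x \in derived.

Definition abelianization : lmodType K := quotient derived.

End Abelianization.

Section LeibnizComplex.
Context (K : fieldType) (g : leibnizAlgType K).

(* The sequence x with [x_i, x_j] in place of x_i and x_j omitted: lift j skips
   the index j. *)
Definition contract n (x : {ffun 'I_n -> g}) (i j : 'I_n) :
    {ffun 'I_n.-1 -> g} :=
  [ffun k => if lift j k == i then bracket (x i) (x j) else x (lift j k)].

(* Indices start at 0, so that j.+1 is the exponent j of the usual formula. *)
Definition leibniz_bdf n (x : {ffun 'I_n -> g}) : tensor_power g n.-1 :=
  \sum_(i < n) \sum_(j < n | (i < j)%N)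
    (-1) ^+ j.+1 *: tensor (contract x i j).

Lemma contract_multilinear n (U : lmodType K) (f : {ffun 'I_n.-1 -> g} -> U)
    (i j : 'I_n) :
  multilinear f -> i != j -> multilinear (fun x => f (contract x i j)).
Proof.
move=> fm ij x p a u v; have ji : j != i by rewrite eq_sym.
have [i' def_i _] := unlift_some ji.
have lj k : (lift j k == j) = false by rewrite eq_sym (negPf (neq_lift j k)).
have cj w : contract (upd x j w) i j = upd (contract x i j) i' (bracket (x i) w).
  apply/ffunP => k; rewrite !ffunE eqxx (negPf ij) lj.
  by rewrite def_i !(inj_eq lift_inj); case: eqP.
have ci w : contract (upd x i w) i j = upd (contract x i j) i' (bracket w (x j)).
  apply/ffunP => k; rewrite !ffunE eqxx (negPf ji) def_i !(inj_eq lift_inj).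
  by case: eqP.
have [-> | pj] := eqVneq p j; first by rewrite !cj bracketPr fm.
have [-> | pi] := eqVneq p i; first by rewrite !ci bracketPl fm.
have [jp ip] : j != p /\ i != p by rewrite ![_ == p]eq_sym.
have [p' def_p _] := unlift_some jp.
have pi' : (lift j p' == i) = false by rewrite -def_p (negPf pi).
have cp w : contract (upd x p w) i j = upd (contract x i j) p' w.
  apply/ffunP => k; rewrite !ffunE (negPf ip) (negPf jp) def_p.
  by rewrite (inj_eq lift_inj); case: (eqVneq k p') => [->|//]; rewrite pi'.
by rewrite !cp fm.
Qed.

Fact leibniz_bdf_multilinear n : multilinear (@leibniz_bdf n).
Proof.
move=> x p a u v; rewrite /leibniz_bdf scaler_sumr -big_split /=.
apply: eq_bigr => i _; rewrite scaler_sumr -big_split /=.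
apply: eq_bigr => j ij; have {}ij : i != j by rewrite neq_ltn /= ij.
rewrite (contract_multilinear (@tensor_multilinear _ _ _) ij).
by rewrite scalerDr !scalerA mulrC.
Qed.

Definition leibniz_bd n : {linear tensor_power g n -> tensor_power g n.-1} :=
  tensor_lift (@leibniz_bdf_multilinear n).

Lemma leibniz_bdE n x : leibniz_bd n (tensor x) = leibniz_bdf x.
Proof. exact: tensor_liftE. Qed.

Definition HL n : lmodType K := homology (leibniz_bd n.+1) (leibniz_bd n).

End LeibnizComplex.

Section ChevalleyEilenberg.
Context (K : fieldType) (g : lieAlgType K).

Definition ce_bdf n (x : {ffun 'I_n -> g}) : exterior_power g n.-1 :=
  \sum_(i < n) \sum_(j < n | (i < j)%N)
    (-1) ^+ j.+1 *: wedge (contract x i j).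

Fact ce_bdf_multilinear n : multilinear (@ce_bdf n).
Proof.
move=> x p a u v; rewrite /ce_bdf scaler_sumr -big_split /=.
apply: eq_bigr => i _; rewrite scaler_sumr -big_split /=.
apply: eq_bigr => j ij; have {}ij : i != j by rewrite neq_ltn /= ij.
rewrite (contract_multilinear (@wedge_multilinear _ _ _) ij).
by rewrite scalerDr !scalerA mulrC.
Qed.

Lemma bracketC (x y : g) : bracket x y = - bracket y x.
Proof.
apply/eqP; rewrite -addr_eq0; have := bracketxx (x + y).
have Dl u v w : bracket (u + v) w = bracket u w + bracket v w :> g.
  by have := bracketPl w 1 u v; rewrite !scale1r.
have Dr u v w : bracket u (v + w) = bracket u v + bracket u w :> g.
  by have := bracketPr u 1 v w; rewrite !scale1r.
by rewrite Dl !Dr !bracketxx add0r addr0 => ->.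
Qed.

Lemma ce_bdf_alternating n : alternating (@ce_bdf n).
Proof.
apply: alternating_adjacent; first exact: ce_bdf_multilinear.
move=> x k l lk xkl; have kl : k != l by rewrite neq_ltn /= lk ltnSn.
have lk' : l != k by rewrite eq_sym.
rewrite /ce_bdf (exchange_big_dep predT) //=.
have wout (i j : 'I_n) : i != k -> i != l -> j != k -> j != l ->
    wedge (contract x i j) = 0.
  move=> ik il jk jl; have [k' defk _] := unlift_some jk.
  have [l' defl _] := unlift_some jl.
  apply: (@wedge_alternating _ _ _ _ k' l').
    by rewrite -(inj_eq (@lift_inj _ j)) -defk -defl.
  by rewrite !ffunE -defk -defl ![_ == i]eq_sym (negPf ik) (negPf il).
have wkl : wedge (contract x k l) = 0.
  have [k' defk _] := unlift_some lk'.
  apply: (multilinear0 (i := k') (@wedge_multilinear _ _ _)).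
  by rewrite ffunE -defk eqxx xkl bracketxx.
have weq (i : 'I_n) : i != k -> i != l ->
    wedge (contract x i k) = wedge (contract x i l).
  move=> ik il; congr wedge; apply/ffunP => m; rewrite !ffunE xkl.
  have [mk | mk] := eqVneq (m : nat) k.
    have -> : lift k m = l.
      by apply: val_inj; rewrite /= /bump mk leqnn lk.
    have -> : lift l m = k.
      by apply: val_inj; rewrite /= /bump mk lk ltnn.
    by rewrite ![_ == i]eq_sym (negPf ik) (negPf il) xkl.
  have -> : lift k m = lift l m; last by [].
    by apply: val_inj; rewrite /= /bump lk ltn_neqAle eq_sym mk.
have wswap (j : 'I_n) : (l < j)%N ->
    wedge (contract x k j) + wedge (contract x l j) = 0.
  move=> lj; have kj : (k < j)%N by rewrite (ltn_trans _ lj) // lk.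
  have jk : j != k by rewrite neq_ltn /= kj orbT.
  have jl : j != l by rewrite neq_ltn /= lj orbT.
  have [k' defk _] := unlift_some jk; have [l' defl _] := unlift_some jl.
  have kl' : k' != l'.
    by rewrite -(inj_eq (@lift_inj _ j)) -defk -defl.
  pose y : {ffun 'I_n.-1 -> g} := [ffun m => x (lift j m)].
  rewrite -(alternating_swap (@wedge_multilinear _ _ _) kl' _ y
             (bracket (x k) (x j)) (x k)); last first.
    by move=> z; apply: wedge_alternating.
  congr (wedge _ + wedge _); apply/ffunP => m; rewrite !ffunE.
    rewrite defk (inj_eq lift_inj); case: (eqVneq m l') => [->|//].
    by rewrite eq_sym (negPf kl') -defk -defl xkl.
  rewrite {1}defl (inj_eq lift_inj); case: (eqVneq m l') => [_|_].
    by rewrite xkl.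
  by case: (eqVneq m k') => [->|//]; rewrite -defk.
rewrite (bigD1 k) //= [X in _ + X](bigD1 l) //= addrA [X in _ + X]big1 ?addr0; last first.
  move=> j /andP[jk jl]; have [lj | jl'] := ltnP l j.
    have kj : (k < j)%N by rewrite (ltn_trans _ lj) // lk.
    rewrite (bigD1 k) //= (bigD1 l) /=; last by rewrite lj.
    rewrite addrA -scalerDr wswap // scaler0 add0r big1 // => i.
    by move=> /andP[/andP[_ ik] il]; rewrite wout ?scaler0.
  apply: big1 => i ij; rewrite wout ?scaler0 //.
    apply: contraTneq ij => ->; rewrite -leqNgt -ltnS -lk.
    by rewrite ltn_neqAle jl' andbT.
  by apply: contraTneq ij => ->; rewrite -leqNgt.
rewrite [X in _ + X](bigD1 k) ?lk //= wkl scaler0 add0r.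
rewrite [X in _ + X](eq_bigl (fun i : 'I_n => (i < k)%N)); last first.
  by move=> i; rewrite ltnS [RHS]ltn_neqAle andbC.
rewrite -big_split big1 //= => i ik; rewrite weq.
- by rewrite -scalerDl [_ ^+ k.+2]exprS mulN1r addrN scale0r.
- by rewrite neq_ltn /= ik.
- by rewrite neq_ltn /= lk ltnS ltnW.
Qed.

Definition ce_bd n : {linear exterior_power g n -> exterior_power g n.-1} :=
  exterior_lift (@ce_bdf_multilinear n) (@ce_bdf_alternating n).

Lemma ce_bdE n x : ce_bd n (wedge x) = ce_bdf x.
Proof. exact: exterior_liftE. Qed.

Definition HCE n : lmodType K := homology (ce_bd n.+1) (ce_bd n).

Lemma to_exterior_bd n (c : tensor_power g n) :
  ce_bd n (to_exterior _ _ c) = to_exterior _ _ (leibniz_bd g n c).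
Proof.
apply: (@tensor_lin_eq _ _ _ _ (ce_bd n \o to_exterior _ _)
         (to_exterior _ _ \o leibniz_bd g n)) => x /=.
rewrite [LHS]ce_bdE leibniz_bdE linear_sum; apply: eq_bigr => i _.
by rewrite linear_sum; apply: eq_bigr => j _; rewrite linearZ.
Qed.

Fact to_exterior_cycle n (z : subspace (kernel (leibniz_bd g n))) :
  (to_exterior _ _ \o incl _) z \in kernel (ce_bd n).
Proof.
apply/kernelP; rewrite /= to_exterior_bd.
by have /kernelP -> := incl_mem z; rewrite linear0.
Qed.

Definition cycle_map n :
    {linear subspace (kernel (leibniz_bd g n)) -> subspace (kernel (ce_bd n))} :=
  corestr (@to_exterior_cycle n).

Definition cycle_class_map n :
    {linear subspace (kernel (leibniz_bd g n)) -> HCE n} :=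
  qproj (boundary (ce_bd n.+1) (ce_bd n)) \o cycle_map n.

Fact cycle_class_map_boundary n :
  {subset boundary (leibniz_bd g n.+1) (leibniz_bd g n)
    <= kernel (cycle_class_map n)}.
Proof.
move=> z /boundaryP[c dc]; apply/kernelP/eqP; rewrite /= qproj_eq0.
apply/boundaryP; exists (to_exterior _ _ c).
by rewrite to_exterior_bd dc [RHS]incl_corestr.
Qed.

Definition natural_map n : {linear HL g n -> HCE n} :=
  qlift (@cycle_class_map_boundary n).

Lemma natural_mapE n (z : subspace (kernel (leibniz_bd g n))) :
  natural_map n (qproj _ z) = qproj _ (cycle_map n z).
Proof. exact: qliftE. Qed.

Lemma natural_map2_surj (w : HCE 2) : exists z : HL g 2, natural_map 2 z = w.
Proof.
have [c <-] := qproj_surj w; have [t def_c] := qproj_surj (incl _ c).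
have tK : t \in kernel (leibniz_bd g 2).
  apply/kernelP; have /kernelP := incl_mem c; rewrite -def_c to_exterior_bd.
  move/eqP; rewrite qproj_eq0; apply: span_empty => r [x [i [j [+ _ _]]]].
  by rewrite [i]ord1 [j]ord1 eqxx.
have [z def_t] := incl_surj tK.
exists (qproj _ z); rewrite natural_mapE; congr (qproj _ _).
by apply: incl_inj; rewrite [LHS]incl_corestr /= def_t def_c.
Qed.

End ChevalleyEilenberg.

(* Main.v *)
(* Let A be the abelianization of g. The map x (x) y |-> phi(x, y) on cycles,
   for a bilinear phi on A, kills Leibniz boundaries because each of their terms
   contains a bracket, so it descends to HL_2(g). The classes of x (x) x lie in
   Ker t, so it is enough to find phi : A x A -> Gamma(A) with
   phi(a, a) = gamma(a); then V = Ker t works. Such a phi exists for every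
   quadratic map q on a vector space: a partial one, defined on W x W, extends
   to W + K e by
   phi(w + c e, w' + c' e) = phi(w, w') + c' b(w, e) + c c' q(e),
   where b is the polar form of q, and Zorn's lemma applies.
   If t is injective then Gamma(A) = 0; but for a <> 0 in A and a linear form l
   with l(a) = 1, the quadratic map l^2 shows that gamma(a) <> 0. *)
From HB Require Import structures.
Require Import Defs.
From mathcomp Require Import all_boot all_algebra.
From mathcomp Require Import finmap boolp classical_sets ring.
From mathcomp.multinomials Require Import monalg.

Import GRing.Theory.
Local Open Scope ring_scope.

(** If [c] and [c'] differed, [e] would equal [(c - c')^-1 *: (w' - w)], an element of [W]. *)
Lemma line_decomposition_uniq {K : fieldType} {A : lmodType K} {W : A -> Prop}
    {e : A} :
  (forall k x y, W x -> W y -> W (k *: x + y)) -> ~ W e ->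
  forall w w' c c', W w -> W w' -> w + c *: e = w' + c' *: e ->
  w = w' /\ c = c'.
Proof.
move=> Wlin We w w' c c' Ww Ww' eq_ww'.
have [cc'|cc'] := eqVneq c c'.
  by split=> //; move: eq_ww'; rewrite cc' => /addIr.
have W0 : W 0 by rewrite -(addNr w) -scaleN1r; apply: Wlin.
case: We; have -> : e = (c - c')^-1 *: (-1 *: w + w') + 0.
  rewrite addr0 scaleN1r; apply: (scalerI (a := c - c')).
    by rewrite subr_eq0.
  rewrite scalerA divff ?subr_eq0 // scale1r scalerBl; apply/eqP.
  by rewrite subr_eq -addrA -eq_ww' addKr.
by apply: (Wlin) => //; apply: Wlin.
Qed.

(** * Quadratic maps as diagonals of bilinear maps *)

Section QuadraticMaps.
Context {K : fieldType} {A U : lmodType K}.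

Definition polar (q : A -> U) (x y : A) : U := q (x + y) - q x - q y.

(** Linearity on one side is enough, as [polar q] is symmetric. *)
Definition quadratic (q : A -> U) :=
  (forall k x, q (k *: x) = k ^+ 2 *: q x) /\
  (forall y, linear (polar q ^~ y)).

(* The graph of a bilinear map on W x W with diagonal q, where
   W = {x | G (x, x, q x)}; W may be empty, so that the union of the empty chain
   qualifies. *)
Definition bilinear_graph (q : A -> U) (G : set (A * A * U)) :=
  [/\ forall x y u v, G (x, y, u) -> G (x, y, v) -> u = v,
      forall k x x' y u u', G (x, y, u) -> G (x', y, u') ->
        G (k *: x + x', y, k *: u + u'),
      forall k x y y' u u', G (x, y, u) -> G (x, y', u') ->
        G (x, k *: y + y', k *: u + u'),
      forall x y u, G (x, y, u) -> G (x, x, q x) /\ G (y, y, q y)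
    & forall x y u v, G (x, x, u) -> G (y, y, v) -> exists w, G (x, y, w)].

(** Each condition starts from at most two points of the union, and some member of the chain
    contains both ([two]). *)
Lemma bilinear_graph_chain q (F : set (set (A * A * U))) :
  (F `<=` bilinear_graph q)%classic -> total_on F subset ->
  bilinear_graph q (\bigcup_(G in F) G)%classic.
Proof.
move=> Fq Ftot.
have two p p' : (\bigcup_(G in F) G)%classic p ->
    (\bigcup_(G in F) G)%classic p' -> exists G, [/\ F G, G p & G p'].
  move=> [G FG Gp] [G' FG' Gp'].
  by case: (Ftot _ _ FG FG') => [/(_ p)|/(_ p')] sub; [exists G'|exists G];
    split=> //; apply: sub.
split.
- by move=> x y u v xyu /(two _ _ xyu)[G [/Fq[+ _ _ _ _]]]; apply.
- move=> k x x' y u u' xyu /(two _ _ xyu)[G [FG Gp Gp']]; exists G => //.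
  by have [_ + _ _ _] := Fq _ FG; apply.
- move=> k x y y' u u' xyu /(two _ _ xyu)[G [FG Gp Gp']]; exists G => //.
  by have [_ _ + _ _] := Fq _ FG; apply.
- move=> x y u [G FG Gp]; have [_ _ _ + _] := Fq _ FG.
  by case/(_ _ _ _ Gp) => Gx Gy; split; exists G.
- move=> x y u v xu /(two _ _ xu)[G [FG Gp Gp']]; have [_ _ _ _ H] := Fq _ FG.
  by have [w Gw] := H _ _ _ _ Gp Gp'; exists w, G.
Qed.

(** [G] has a triple over [(y, x)]; adding to it, on the left, [k] times the triple over [(x, x)]
    brings [k *: x + y] into the domain. *)
Lemma bilinear_graph_dom q G : bilinear_graph q G ->
  forall k x y, G (x, x, q x) -> G (y, y, q y) ->
  G (k *: x + y, k *: x + y, q (k *: x + y)).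
Proof.
move=> [_ Gl _ Gd Gt] k x y Gx Gy; have [w Gyx] := Gt _ _ _ _ Gy Gx.
by have [] := Gd _ _ _ (Gl k _ _ _ _ _ Gx Gyx).
Qed.

(** The choice made is phi(w, e) = b(w, e) and phi(e, w') = 0. This asymmetry avoids dividing by 2,
    so the characteristic is arbitrary. *)
Definition graph_extension (q : A -> U) (G : set (A * A * U)) (e : A) :
    set (A * A * U) := fun p =>
  exists w c w' c' v, G (w, w', v) /\
    p = (w + c *: e, w' + c' *: e,
         v + (c' *: polar q w e + (c * c') *: q e)).

(** The right-hand side is the value that [graph_extension] takes on the diagonal, so the extension
    still has diagonal [q]. *)
Lemma quadratic_affine q : quadratic q -> forall w c e,
  q (w + c *: e) = q w + (c *: polar q w e + (c * c) *: q e).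
Proof.
move=> [qZ qD] w c e.
have polarC x y : polar q x y = polar q y x.
  by rewrite /polar [y + x]addrC addrAC.
have polar0 y : polar q 0 y = 0.
  have := qD y 1 0 0; rewrite !scale1r addr0 => /eqP.
  by rewrite -subr_eq subrr eq_sym => /eqP.
have <- : polar q w (c *: e) = c *: polar q w e.
  by rewrite polarC [polar q w e]polarC -[c *: e]addr0 qD polar0 addr0.
by rewrite -expr2 -qZ /polar subrK [RHS]addrC subrK.
Qed.

(** Uniqueness of coordinates in W + K e makes the extension single-valued. For linearity it
    identifies the two decompositions of the argument that both triples share. *)
Lemma graph_extension_bilinear q G e : quadratic q -> bilinear_graph q G ->
  ~ G (e, e, q e) -> bilinear_graph q (graph_extension q G e).
Proof.
move=> qq Gq Ge; have Glin := bilinear_graph_dom _ _ Gq.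
have uniq := line_decomposition_uniq (W := fun x => G (x, x, q x)) Glin Ge.
have [Gf Gl Gr Gd Gt] := Gq; have [_ qD] := qq; split.
- move=> x y u v [w [c [w' [c' [t [Gw [-> -> ->]]]]]]].
  move=> [w1 [c1 [w1' [c1' [t1 [Gw1 [+ + ->]]]]]]].
  have [Gww Gww'] := Gd _ _ _ Gw; have [Gww1 Gww1'] := Gd _ _ _ Gw1.
  move=> /uniq -/(_ Gww Gww1)[ew ->] /uniq -/(_ Gww' Gww1')[ew' ->].
  by move: Gw; rewrite ew ew' => /Gf/(_ Gw1) ->.
- move=> k x x' y u u' [w [c [w' [c' [t [Gw [-> -> ->]]]]]]].
  move=> [w1 [c1 [w1' [c1' [t1 [Gw1 [-> + ->]]]]]]].
  have [Gww Gww'] := Gd _ _ _ Gw; have [Gww1 Gww1'] := Gd _ _ _ Gw1.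
  move=> /uniq -/(_ Gww' Gww1')[ew ec].
  exists (k *: w + w1), (k * c + c1), w', c', (k *: t + t1); split.
    by apply: Gl => //; rewrite ew.
  rewrite -ec; congr (_, _, _).
    by rewrite scalerDr scalerDl scalerA addrACA.
  rewrite qD mulrDl !scalerDr scalerDl !scalerA !mulrA [c' * k]mulrC.
  by rewrite addrACA [X in _ + X]addrACA.
- move=> k x y y' u u' [w [c [w' [c' [t [Gw [-> -> ->]]]]]]].
  move=> [w1 [c1 [w1' [c1' [t1 [Gw1 [+ -> ->]]]]]]].
  have [Gww Gww'] := Gd _ _ _ Gw; have [Gww1 Gww1'] := Gd _ _ _ Gw1.
  move=> /uniq -/(_ Gww Gww1)[ew ec].
  exists w, c, (k *: w' + w1'), (k * c' + c1'), (k *: t + t1); split.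
    by apply: Gr => //; rewrite ew.
  rewrite -ec -ew; congr (_, _, _).
    by rewrite scalerDr scalerDl scalerA addrACA.
  move: (polar q w e) => b.
  rewrite mulrDr !scalerDr !scalerDl !scalerA [c * (k * c')]mulrCA.
  by rewrite addrACA [X in _ + X]addrACA.
- move=> x y u [w [c [w' [c' [t [Gw [-> -> _]]]]]]].
  have [Gww Gww'] := Gd _ _ _ Gw.
  by split; [exists w, c, w, c, (q w)|exists w', c', w', c', (q w')];
    rewrite quadratic_affine.
- move=> x y u v [w [c [_ [_ [t [/Gd[Gw _] [-> _ _]]]]]]].
  move=> [w' [c' [_ [_ [t' [/Gd[Gw' _] [-> _ _]]]]]]].
  have [s Gs] := Gt _ _ _ _ Gw Gw'.
  by eexists; exists w, c, w', c', s; split.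
Qed.

Lemma quadratic_diagonal q : quadratic q ->
  exists phi : A -> A -> U,
    [/\ forall y, linear (phi ^~ y), forall x, linear (phi x)
      & forall x, phi x x = q x].
Proof.
move=> qq; have [G [Gq Gmax]] := Zorn_bigcup (@bilinear_graph_chain q).
have [Gf Gl Gr Gd Gt] := Gq; have [qZ _] := qq.
have q0 : q 0 = 0 by rewrite -(scale0r 0) qZ expr0n scale0r.
(* The empty set is a bilinear graph too; maximality excludes it, because [(0, 0, 0)] alone forms a
   larger one. *)
have G0 : G (0, 0, 0).
  have [[[[x y] u] Gx]|Gn] := pselect (exists p, G p).
    have [{}Gx _] := Gd _ _ _ Gx.
    have := bilinear_graph_dom _ _ Gq (-1) _ _ Gx Gx.
    by rewrite scaleN1r addNr q0.
  exfalso; apply: (Gmax [set (0, 0, 0)]%classic).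
    split; first by move=> p Gp; case: Gn; exists p.
    by move=> /(_ (0, 0, 0) erefl) G0; apply: Gn; exists (0, 0, 0).
  split.
  - by move=> x y u v [_ _ ->] [_ _ ->].
  - by move=> k x x' y u u' [-> -> ->] [-> ->]; rewrite !scaler0 !addr0.
  - by move=> k x y y' u u' [-> -> ->] [-> ->]; rewrite !scaler0 !addr0.
  - by move=> x y u [-> -> _]; rewrite q0.
  - by move=> x y u v [-> _ _] [-> _ _]; exists 0.
(* Otherwise the extension along [x] is strictly larger: coordinates [c = c' = 0] recover [G], and
   [0 + 1 *: x] is a new point of the domain. *)
have Gx x : G (x, x, q x).
  apply: contrapT => Gnx; apply: (Gmax (graph_extension q G x)).
    split=> [[[y z] u] Gy|].
      exists y, 0, z, 0, u; split => //.
      by rewrite !scale0r mul0r scale0r !addr0.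
    move=> /(_ (x, x, q x)); apply: contra_not Gnx; apply.
    exists 0, 1, 0, 1, 0; split => //.
    have := quadratic_affine _ qq 0 1 x; rewrite q0 => <-.
    by rewrite scale1r add0r.
  exact: graph_extension_bilinear.
(* The domain is now all of [A]; single-valuedness of [G] turns its closure properties into
   bilinearity of [phi]. *)
have /choice[phi phiP] (p : A * A) : exists u, G (p.1, p.2, u).
  by apply: (Gt _ _ (q p.1) (q p.2)).
exists (fun x y => phi (x, y)); split.
- by move=> y k x x'; apply: (Gf _ _ _ _ (phiP (_, _))); apply: Gl;
    [exact: (phiP (x, y))|exact: (phiP (x', y))].
- by move=> x k y y'; apply: (Gf _ _ _ _ (phiP (_, _))); apply: Gr;
    [exact: (phiP (x, y))|exact: (phiP (x, y'))].
- by move=> x; apply: (Gf _ _ _ _ (phiP (_, _))).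
Qed.

End QuadraticMaps.

(** * Linear forms that detect a nonzero vector *)

(** If [W] is maximal among the subspaces avoiding [e], then W + K e is the whole space, and [l] is
    the coordinate along [e]. *)
Lemma separating_functional {K : fieldType} {A : lmodType K} (e : A) : e != 0 ->
  exists l : A -> K, l e = 1 /\ forall k x y, l (k *: x + y) = k * l x + l y.
Proof.
move=> e0.
pose P (W : set A) :=
  (forall k x y, W x -> W y -> W (k *: x + y)) /\ ~ W e.
have [|W [[Wlin We] Wmax]] := @Zorn_bigcup A P.
  move=> F FP Ftot; split; last by move=> [W /FP[]].
  move=> k x y [W FW Wx] [W' FW' Wy].
  case: (Ftot _ _ FW FW') => sub; [exists W'|exists W] => //.
    by apply: (FP _ FW').1 => //; apply: sub.
  by apply: (FP _ FW).1 => //; apply: sub.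
(* [P] also holds of the empty set; maximality excludes it, since [{0}] satisfies [P]. *)
have W0 : W 0.
  have [[x Wx]|Wn] := pselect (exists x, W x).
    by rewrite -(addNr x) -scaleN1r; apply: Wlin.
  exfalso; apply: (Wmax [set 0]%classic).
    by split; [move=> x Wx; case: Wn; exists x|
      move=> /(_ 0 erefl) ?; apply: Wn; exists 0].
  by split; [move=> k x y -> ->; rewrite scaler0 addr0|apply/eqP].
have /choice[l lP] y : exists c, W (y - c *: e).
  have [Wy|Wy] := pselect (W y); first by exists 0; rewrite scale0r subr0.
  apply: contrapT => nc.
  (* For [y] outside [W], maximality forces [e] into W + K y; solving [e = w + k *: y] for [y]
     contradicts [nc]. *)
  apply: (Wmax [set x | exists w k, W w /\ x = w + k *: y]%classic).
    split=> [x Wx|sub]; first by exists x, 0; rewrite scale0r addr0.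
    by apply/Wy/sub; exists 0, 1; rewrite scale1r add0r.
  split=> [k _ _ [w [c [Ww ->]]] [w' [c' [Ww' ->]]]|[w [k [Ww def_e]]]].
    exists (k *: w + w'), (k * c + c'); split; first exact: Wlin.
    by rewrite scalerDr scalerDl scalerA addrACA.
  have k0 : k != 0.
    by apply: contra_notN We => /eqP k0; rewrite def_e k0 scale0r addr0.
  apply: nc; exists k^-1.
  have -> : y - k^-1 *: e = - k^-1 *: w + 0.
    rewrite def_e scalerDr scalerA mulVf // scale1r addr0 scaleNr opprD.
    by rewrite addrCA subrr addr0.
  exact: Wlin.
exists l; split.
  apply: (line_decomposition_uniq Wlin We _ _ _ _ (lP e) W0 _).2.
  by rewrite subrK scale1r add0r.
move=> k x y.
apply: (line_decomposition_uniq Wlin We _ _ _ _ (lP (k *: x + y))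
  (Wlin k _ _ (lP x) (lP y)) _).2.
by rewrite subrK scalerDl -scalerA addrACA -scalerDr !subrK.
Qed.

(** * The universal quadratic map [gamma] *)

Lemma gammaZ {K : fieldType} {A : lmodType K} (k : K) (a : A) :
  gamma (k *: a) = k ^+ 2 *: gamma a.
Proof.
have [r def_r] : {r : {malg K[A]} | r = k ^+ 2 *: << a >> - << k *: a >>}.
  by eexists.
have /pgen_respects : Gamma_rel r by constructor 1; exists k, a.
by rewrite def_r linearB linearZ !free_liftU => /eqP; rewrite subr_eq0 => /eqP.
Qed.

Lemma gammaDD {K : fieldType} {A : lmodType K} (a b c : A) :
  gamma (a + b + c) + gamma a + gamma b + gamma c =
  gamma (a + b) + gamma (a + c) + gamma (b + c).
Proof.
have [r def_r] : {r : {malg K[A]} |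
    r = (<< a + b + c >> + << a >> + << b >> + << c >>)
        - (<< a + b >> + << a + c >> + << b + c >>)} by eexists.
have /pgen_respects : Gamma_rel r by constructor 2; exists a, b, c.
rewrite def_r linearB => /eqP; rewrite subr_eq0 => /eqP.
by rewrite !linearD !free_liftU.
Qed.

Lemma gammaZD {K : fieldType} {A : lmodType K} (k : K) (a b : A) :
  gamma (k *: a + b) + k *: gamma a + k *: gamma b =
  k *: gamma (a + b) + gamma (k *: a) + gamma b.
Proof.
have [r def_r] : {r : {malg K[A]} |
    r = (<< k *: a + b >> + k *: << a >> + k *: << b >>)
        - (k *: << a + b >> + << k *: a >> + << b >>)} by eexists.
have /pgen_respects : Gamma_rel r by constructor 3; exists k, a, b.
rewrite def_r linearB => /eqP; rewrite subr_eq0 => /eqP.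
by rewrite !linearD !linearZ !free_liftU.
Qed.

(** Rearranged, [gammaZD] says that the polar form of [gamma] is homogeneous in its first argument,
    and [gammaDD] that it is additive there. *)
Lemma gamma_quadratic {K : fieldType} {A : lmodType K} :
  quadratic (@gamma K A).
Proof.
split=> [|y k a b]; first exact: gammaZ.
have polarZ : polar (@gamma K A) (k *: a) y = k *: polar (@gamma K A) a y.
  rewrite /polar !scalerBr.
  have /(canRL (addrK _))/(canRL (addrK _)) -> := gammaZD k a y.
  by rewrite [LHS](AC 7 ((1*5*4)*(2*6)*(3*7)))/= !addrN !addr0.
rewrite -polarZ; move: (k *: a) => {polarZ}a; rewrite /polar.
have := gammaDD a b y.
move=> /(canRL (addrK _))/(canRL (addrK _))/(canRL (addrK _)) ->.
by rewrite [LHS](AC 8 ((1*7)*((2*6*4)*(3*5*8))))/= addrN add0r.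
Qed.

Lemma gamma_neq0 {K : fieldType} {A : lmodType K} (a : A) : a != 0 ->
  gamma a != 0.
Proof.
move=> /separating_functional[l [la ll]].
have l0 : l 0 = 0 by have := ll (-1) a a; rewrite scaleN1r addNr mulN1r addNr.
have lZ k x : l (k *: x) = k * l x by rewrite -[k *: x]addr0 ll l0 addr0.
have lD x y : l (x + y) = l x + l y by rewrite -[x]scale1r ll mul1r scale1r.
pose h (x : A) : K^o := l x ^+ 2.
(* The three relations become polynomial identities valid in every commutative ring, so
   characteristic 2 is no exception. *)
have hR : respects (@Gamma_rel K A) h.
  move=> r [[k [x ->]]|[x [y [z ->]]]|[k [x [y ->]]]];
    rewrite linearB; apply/eqP; rewrite subr_eq0; apply/eqP;
    rewrite ?linearD ?linearZ /= !free_liftU /h ?lD ?lZ;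
    by rewrite -?[_ *: _]/(_ * _ : K); ring.
have hE : plift hR (gamma a) = 1 by rewrite [LHS]pliftE /h la expr1n.
by apply: contra_eq_neq hE => ->; rewrite linear0 eq_sym oner_eq0.
Qed.

(** * Surjectivity onto [Gamma] *)

Section LinearRange.
Context {K : fieldType} {U V : lmodType K} (f : {linear U -> V}).

Definition linear_range_pred : {pred V} := fun v => `[< exists u, f u = v >].

Fact linear_range_submod : subsemimod_closed linear_range_pred.
Proof.
split; first split.
- by apply/asboolP; exists 0; rewrite linear0.
- move=> _ _ /asboolP[u <-] /asboolP[v <-]; apply/asboolP.
  by exists (u + v); rewrite linearD.
- move=> a _ /asboolP[u <-]; apply/asboolP.
  by exists (a *: u); rewrite linearZ.
Qed.

HB.instance Definition _ :=
  GRing.isSubmodClosed.Build K V linear_range_pred linear_range_submod.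

Definition linear_range : submodClosed V := linear_range_pred.

End LinearRange.

(** The projection of [Gamma A] modulo the range of [f] kills every generator [gamma a], hence is
    zero. *)
Lemma Gamma_linear_surj {K : fieldType} {A V : lmodType K}
    (f : {linear V -> Gamma A}) :
  (forall a, exists v, f v = gamma a) -> forall y, exists v, f v = y.
Proof.
move=> fgamma y; suff /asboolP : y \in linear_range f by [].
rewrite -qproj_eq0; apply/eqP.
apply: (@presented_lin_eq K A (@Gamma_rel K A) _ (qproj (linear_range f)) \0).
by move=> a; apply/eqP; rewrite qproj_eq0; apply/asboolP/fgamma.
Qed.

(** * Evaluating a bilinear map of the abelianization on second Leibniz homology *)

Section FormOnHL2.
Context {K : fieldType} {g : lieAlgType K} {U : lmodType K}.
Context (phi : abelianization g -> abelianization g -> U).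
Context (phil : forall y, linear (phi ^~ y)) (phir : forall x, linear (phi x)).

Let ab : {linear g -> abelianization g} := qproj (derived g).

Lemma ab_bracket (x y : g) : ab (bracket x y) = 0.
Proof. by apply/eqP; rewrite qproj_eq0 mem_span //; exists x, y. Qed.

Definition ab_form (x : {ffun 'I_2 -> g}) : U :=
  phi (ab (x ord0)) (ab (x ord_max)).

Lemma ab_form_multilinear : multilinear ab_form.
Proof.
move=> x i a u v; rewrite /ab_form !ffunE.
have [<-|i0] := eqVneq ord0 i; first by rewrite linearP phil.
have -> : i = ord_max by case: i i0 => [[|[|]]] // ? _; apply: val_inj.
by rewrite eqxx linearP phir.
Qed.

Lemma ab_form_bd : forall c : tensor_power g 3,
  tensor_lift ab_form_multilinear (leibniz_bd g 3 c) = 0.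
Proof.
apply: (@tensor_lin_eq K g 3 U
  (tensor_lift ab_form_multilinear \o leibniz_bd g 3) \0) => x /=.
rewrite leibniz_bdE linear_sum big1 // => i _.
rewrite linear_sum big1 // => j ij.
rewrite linearZ /= tensor_liftE.
have ji : j != i by rewrite neq_ltn /= ij orbT.
(* [i'] is the position of the bracket in [contract x i j]; whether it is 0 or 1, one argument of
   [phi] vanishes. *)
have [i' def_i _] := unlift_some ji.
have ci : ab (contract x i j i') = 0 by rewrite ffunE -def_i eqxx ab_bracket.
have phi0l y : phi 0 y = 0.
  by have := phil y (-1) 0 0; rewrite scaleN1r oppr0 addr0 scaleN1r addNr.
have phi0r y : phi y 0 = 0.
  by have := phir y (-1) 0 0; rewrite scaleN1r oppr0 addr0 scaleN1r addNr.
rewrite /ab_form; have [e|i0] := eqVneq i' ord0.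
  by rewrite -e ci phi0l scaler0.
have <- : i' = ord_max :> 'I_2.
  by case: i' i0 {def_i ci} => [[|[|]]] // ? _; apply: val_inj.
by rewrite ci phi0r scaler0.
Qed.

Fact ab_form_boundary :
  {subset boundary (leibniz_bd g 3) (leibniz_bd g 2)
    <= kernel (tensor_lift ab_form_multilinear
                 \o incl (kernel (leibniz_bd g 2)))}.
Proof.
by move=> z /boundaryP[c dc]; apply/kernelP; rewrite /= -dc ab_form_bd.
Qed.

Definition ab_form_HL : {linear HL g 2 -> U} := qlift ab_form_boundary.

(** The tensor square of [x] is a cycle because [x, x] = 0, and its image in the exterior square is
    the wedge of [x] with itself, which is 0. *)
Lemma diagonal_class (x : g) : exists z : HL g 2,
  natural_map g 2 z = 0 /\ ab_form_HL z = phi (ab x) (ab x).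
Proof.
have [z def_z] : exists z, incl (kernel (leibniz_bd g 2)) z = tensor [ffun=> x].
  apply: incl_surj; apply/kernelP.
  rewrite leibniz_bdE [LHS]big1 // => i _; rewrite big1 // => j ij.
  have ji : j != i by rewrite neq_ltn /= ij orbT.
  have [i' def_i _] := unlift_some ji.
  rewrite (multilinear0 (i := i') (@tensor_multilinear _ _ _)) ?scaler0 //.
  by rewrite !ffunE -def_i eqxx bracketxx.
exists (qproj _ z); split.
  rewrite natural_mapE -[RHS](linear0 (qproj _)); congr (qproj _ _).
  apply: incl_inj; rewrite [LHS]incl_corestr /= def_z linear0.
  by apply: (@wedge_alternating _ _ _ _ ord0 ord_max) => //; rewrite !ffunE.
by rewrite [LHS]qliftE /= def_z tensor_liftE /ab_form !ffunE.
Qed.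

End FormOnHL2.

Theorem proposition6p1 (K : fieldType) (g : lieAlgType K) :
  (exists V : submodClosed (HL g 2),
     {subset V <= kernel (natural_map g 2)} /\
     exists f : {linear subspace V -> Gamma (abelianization g)},
       forall y : Gamma (abelianization g), exists x : subspace V, f x = y) /\
  (~ perfect g -> ~ bijective (natural_map g 2)).
Proof.
have [phi [phil phir phid]] :=
  quadratic_diagonal _ (@gamma_quadratic K (abelianization g)).
pose V := kernel (natural_map g 2).
pose f : {linear subspace V -> Gamma (abelianization g)} :=
  ab_form_HL phi phil phir \o incl V.
have fsurj y : exists x : subspace V, f x = y.
  (* Only generators [gamma y] have to be reached; lifting [y] to [x] in [g], the diagonal class of
     [x] is sent to [phi y y = gamma y]. *)
  apply: Gamma_linear_surj => {}y; have [x <-] := qproj_surj y.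
  have [z [tz fz]] := diagonal_class phi phil phir x.
  have [v def_v] : exists v, incl V v = z by apply/incl_surj/kernelP.
  by exists v; rewrite /f /= def_v fz phid.
split; first by exists V; split=> //; exists f.
move=> nperf /bij_inj tinj; apply: nperf => x; rewrite -qproj_eq0.
apply: contraT => /gamma_neq0/eqP[].
(* A preimage [v] of this [gamma] lies in the kernel of an injective map, so [v] and its image are
   0. *)
have [v <-] := fsurj (gamma (qproj (derived g) x)).
have /kernelP := incl_mem v; rewrite -(linear0 (natural_map g 2)) => /tinj v0.
by rewrite /f /= v0 linear0.
Qed.
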